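(* Let $L=(L,* )$ be a completely distributive lattice with an operation ${*}:L\times L\to L$ that makes it a unital quantale whose two-sided unit is the top element $1$, and let $\alpha\mathbin{\hat *}\beta=\beta*\alpha$. The self-duality $(-)^{\smile}:\mathcal{S}em\mathcal{PR}\to\mathcal{S}em\mathcal{PR}$ extends to contravariant functors $(-)^{\smile}:\mathcal{S}em\mathcal{PR}^*_L\to\mathcal{S}em\mathcal{PR}^{\hat *}_L$ and $(-)^{\smile}:\mathcal{S}em\mathcal{PR}^{\hat *}_L\to\mathcal{S}em\mathcal{PR}^*_L$, acting by $S\mapsto S^\land$ on objects and $R\mapsto R^{\smile}$ on arrows (so that $(I^*_LR)^{\smile}=I^{\hat *}_L(R^{\smile})$ and $(I^{\hat *}_LR)^{\smile}=I^*_L(R^{\smile})$ for each arrow $R$ of $\mathcal{S}em\mathcal{PR}$). Both pairwise compositions of these functors are isomorphic to the identity functors.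
   Context: Order-theoretic conventions. A subset $A$ of a poset is directed if for all $x,y\in A$ there is $z\in A$ with $x\le z$, $y\le z$; non-emptiness is not required, so the empty set is directed. A dcpo is a poset in which all directed subsets have suprema. One writes $x\ll y$ ($x$ is way below $y$) iff for every directed $D$ having a supremum, $y\le\sup D$ implies $x\le d$ for some $d\in D$ (so nothing is way below the least element). A continuous semilattice is a meet semilattice which is a dcpo and in which, for each $y$, the set $\{x\mid x\ll y\}$ is directed with supremum $y$. A subset of a dcpo is Scott closed if it is a lower set closed under suprema of its directed subsets; $\mathrm{Cl}(A)$ is the least Scott closed set containing $A$. For a continuous semilattice $S$ with zero (bottom element), $S^\land$ is the set of all (possibly empty) Scott open filters in $S$ except $S$ itself, ordered by inclusion (a Scott open filter is an upper set $F$ closed under binary meets such that every non-empty directed set $D$ with $\sup D\in F$ meets $F$); $S^\land$ is a continuous semilattice with bottom $\varnothing$, and $s\mapsto\{F\in S^\land\mid s\in F\}$ is an isomorphism $S\to S^{\land\land}$. Crisp case. For continuous semilattices $S_1,S_2$ with zeros, an ambiguous representation of $S_1$ in $S_2$ is a binary relation $R\subset S_1\times S_2$ such that (a) if $(x,y)\in R$, $x\le x'$, $y'\le y$, then $(x',y')\in R$; (b) for all $x\in S_1$ the set $xR=\{y\mid (x,y)\in R\}$ is non-empty and closed under directed suprema in $S_2$. It is pseudo-invertible if whenever $(x,y)\in R$ and $y'\ll y$, there is $x'\ll x$ with $(x',y')\in R$. $\mathcal{S}em\mathcal{PR}$ is the category of continuous semilattices with zeros and pseudo-invertible ambiguous representations,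 with composition $R{;}Q=\{(x,z)\mid z\in\mathrm{Cl}(xRQ)\}$, $xRQ=\{z\mid\exists y:\ (x,y)\in R,(y,z)\in Q\}$, and identities $E_S=\{(x,y)\in S\times S\mid y\le x\}$. Its self-duality $(-)^{\smile}$ is $S\mapsto S^\land$ on objects and, on arrows, $R^{\smile}=\{(G,F)\in S_2^\land\times S_1^\land\mid\text{for each }x\in F\text{ there is }y\in xR\text{ with }y\in G\}$. $L$-fuzzy case. $L$ is a completely distributive lattice with bottom $0$ and top $1$. An $L$-ambiguous representation of $S_1$ in $S_2$ is a ternary relation $R\subset S_1\times S_2\times L$ such that (a) if $(x,y,\alpha)\in R$, $x\le x'$, $y'\le y$, $\alpha'\le\alpha$, then $(x',y',\alpha')\in R$; (b) for all $x\in S_1$ the set $xR=\{(y,\alpha)\in S_2\times L\mid (x,y,\alpha)\in R\}$ is Scott closed in $S_2\times L$ and contains all elements $(0_2,\alpha)$ and $(y,0)$, where $0_2$ is the zero of $S_2$; (c) if $(x,y,\alpha)\in R$ and $(x,y,\beta)\in R$, then $(x,y,\alpha\lor\beta)\in R$. For such $R$, $$R^{\smile}=\{(G,F,\alpha)\in S_2^\land\times S_1^\land\times L\mid\text{for all }\beta\ll\alpha\text{ and }x\in F\text{ there is }y\in S_2\text{ with }(x,y,\beta)\in R,\ y\in G\}$$ (this is the pseudo-inverse with respect to the separating compatibilities $P_i:S_i\times S_i^\land\to\{0,1\}$, $P_i(x,F)=1\iff x\in F$). $R$ is called pseudo-invertible if $R^{\smile\smile}=R$, where $R^{\smile\smile}=(R^{\smile})^{\smile}$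 is regarded as a subset of $S_1\times S_2\times L$ through the isomorphisms $S_i\cong S_i^{\land\land}$ above. The operation $*$ making $L$ a unital quantale is associative, distributes over arbitrary suprema in each variable, and has $1$ as two-sided unit; commutativity is not assumed. Then $\hat L=(L,\hat * )$ is also a unital quantale. For $R\subset S_1\times S_2\times L$, $Q\subset S_2\times S_3\times L$ put $$R*Q=\{(x,z,\alpha)\in S_1\times S_3\times L\mid \alpha\le\sup\{\beta*\gamma\mid\exists y\in S_2:\ (x,y,\beta)\in R,\ (y,z,\gamma)\in Q\}\},$$ and let $R\overset{*}{,}Q\subset S_1\times S_3\times L$ be given by $x(R\overset{*}{,}Q)=\mathrm{Cl}(x(R*Q))$ for all $x\in S_1$, where $x(\cdot)$ denotes the cut $\{(z,\alpha)\mid(x,z,\alpha)\in\cdot\}$; the composition $\overset{\hat *}{,}$ is defined in the same way from $\hat *$. $\mathcal{S}em\mathcal{PR}^*_L$ (resp. $\mathcal{S}em\mathcal{PR}^{\hat *}_L$) is the category of continuous semilattices with zeros and pseudo-invertible $L$-ambiguous representations with the composition $\overset{*}{,}$ (resp. $\overset{\hat *}{,}$). The embeddings $I^*_L:\mathcal{S}em\mathcal{PR}\to\mathcal{S}em\mathcal{PR}^*_L$ and $I^{\hat *}_L:\mathcal{S}em\mathcal{PR}\to\mathcal{S}em\mathcal{PR}^{\hat *}_L$ preserve objects and both take $R\subset S_1\times S_2$ to $\{(x,y,\alpha)\in S_1\times S_2\times L\mid (x,y)\in R\text{ or }\alpha=0\}$. *)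

(* Defs.v *)
From HB Require Import structures.
From mathcomp Require Import all_boot all_order.
From mathcomp Require Import boolp classical_sets.

Set Implicit Arguments.
Unset Strict Implicit.
Unset Printing Implicit Defensive.

Import Order.Theory.
Local Open Scope order_scope.
Local Open Scope classical_set_scope.

Section OrderNotions.
Context {d : Order.disp_t} {T : porderType d}.
Implicit Types (A D : set T) (x y : T).

(* The empty set counts as directed; hence nothing is way below the least
   element, and Scott closed sets contain the least element. *)
Definition directed A :=
  forall x y, A x -> A y -> exists z, [/\ A z, x <= z & y <= z].

Definition way_below x y :=
  forall D s, directed D -> supremums D s -> y <= s -> exists2 e, D e & x <= e.

Definition scott_closed A :=
  (forall x y, A y -> x <= y -> A x) /\
  (forall D s, directed D -> D `<=` A -> supremums D s -> A s).

Definition scott_closure A : set T := smallest scott_closed A.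

End OrderNotions.

HB.mixin Record isContinuousSemilattice d S of Order.BMeetSemilattice d S := {
  directed_supremums : forall A : set S, directed A -> supremums A !=set0;
  directed_way_below : forall y : S, directed [set x | way_below x y];
  supremums_way_below : forall y : S, supremums [set x | way_below x y] y
}.

#[short(type="contSemilatticeType")]
HB.structure Definition ContSemilattice d :=
  {S of Order.BMeetSemilattice d S & isContinuousSemilattice d S}.

Section Lub.
Context {d : Order.disp_t} {L : tbLatticeType d}.

(* The default values only matter for the empty set, as long as the
   supremum (infimum) exists. *)
Definition lub (A : set L) : L := supremum \bot A.
Definition glb (A : set L) : L := infimum \top A.

End Lub.

HB.mixin Record isCompletelyDistributive d L of Order.TBLattice d L := {
  supremums_neq0 : forall A : set L, supremums A !=set0;
  glb_lub_distr : forall (I : Type) (J : I -> Type) (f : forall i, J i -> L),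
    glb [set lub (range (f i)) | i in [set: I]] =
    lub [set glb (range (fun i => f i (s i))) | s in [set: forall i, J i]]
}.

#[short(type="cdLatticeType")]
HB.structure Definition CDLattice d :=
  {L of Order.TBLattice d L & isCompletelyDistributive d L}.

Record unital_quantale {d : Order.disp_t} {L : cdLatticeType d}
    (star : L -> L -> L) : Prop := UnitalQuantale {
  starA : associative star;
  star_lubl : forall (A : set L) b, star (lub A) b = lub [set star a b | a in A];
  star_lubr : forall a (B : set L), star a (lub B) = lub [set star a b | b in B];
  star1x : left_id \top star;
  starx1 : right_id \top star
}.

Definition opp_star {d : Order.disp_t} {L : cdLatticeType d}
  (star : L -> L -> L) : L -> L -> L := fun a b => star b a.

Definition scott_open_filter {d} {S : contSemilatticeType d} (F : set S) :=
  [/\ forall x y, F x -> x <= y -> F y,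
      forall x y, F x -> F y -> F (x `&` y)%O &
      forall D s, D !=set0 -> directed D -> supremums D s -> F s ->
        D `&` F !=set0].

Record open_filter {d} (S : contSemilatticeType d) := OpenFilter {
  filter_set :> set S;
  filter_open : scott_open_filter filter_set;
  filter_proper : filter_set <> [set: S]
}.

Section WayBelow.
Context {d : Order.disp_t} {S : contSemilatticeType d}.
Implicit Types x y z : S.

Lemma way_belowW x y : way_below x y -> x <= y.
Proof.
have dy : directed [set y] by move=> _ _ -> ->; exists y.
have sy : supremums [set y] y by rewrite supremums1.
by move=> /(_ [set y] y dy sy (lexx y)) [z ->].
Qed.

Lemma way_below_le x x' y y' :
  x <= x' -> way_below x' y' -> y' <= y -> way_below x y.
Proof.
move=> xx' wb yy' D s dD Ds ys.
have [e De x'e] := wb D s dD Ds (le_trans yy' ys).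
by exists e => //; exact: le_trans x'e.
Qed.

Lemma not_way_below_bot x : ~ way_below x \bot.
Proof.
have s0 : supremums set0 (\bot : S) by split=> // y _; exact: le0x.
have d0 : directed (@set0 S) by [].
by move=> /(_ set0 \bot d0 s0 (lexx _)) [].
Qed.

Lemma way_below_interpolation x z :
  way_below x z -> exists2 y, way_below x y & way_below y z.
Proof.
move=> xz.
pose D := [set w | exists2 y, way_below w y & way_below y z].
have dD : directed D.
  move=> w1 w2 [y1 wy1 yz1] [y2 wy2 yz2].
  have [y [yz y1y y2y]] := directed_way_below _ _ _ yz1 yz2.
  have [w [wy w1w w2w]] := directed_way_below _ _ _
    (way_below_le (lexx w1) wy1 y1y) (way_below_le (lexx w2) wy2 y2y).
  by exists w; split=> //; exists y.
have Dz : supremums D z.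
  split=> [w [y wy yz]|u Du].
    exact: le_trans (way_belowW wy) (way_belowW yz).
  apply: (supremums_way_below z).2 => y yz.
  by apply: (supremums_way_below y).2 => w wy; apply: Du; exists y.
have [w [y wy yz] xw] := xz D z dD Dz (lexx z).
by exists y => //; exact: way_below_le xw wy (lexx y).
Qed.

Lemma open_filter_between x y : way_below x y ->
  exists F : open_filter S, filter_set F y /\ F `<=` [set z | x <= z].
Proof.
move=> xy.
pose T := {z | way_below x z}.
have step (t : T) : {u : T | way_below (proj1_sig u) (proj1_sig t)}.
  have /cid2 [z xz zt] := way_below_interpolation (proj2_sig t).
  by exists (exist _ z xz).
pose t n := iter n (fun u => proj1_sig (step u)) (exist _ y xy : T).
have tS n : way_below (proj1_sig (t n.+1)) (proj1_sig (t n)).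
  exact: proj2_sig (step (t n)).
have tD n k : proj1_sig (t (n + k)%N) <= proj1_sig (t n).
  elim: k => [|k IHk]; first by rewrite addn0.
  by rewrite addnS (le_trans _ IHk)// way_belowW.
pose F := [set z | exists n, proj1_sig (t n) <= z].
have oF : scott_open_filter F.
  split=> [z u [n tz] zu|z u [n tz] [m tu]|D s _ dD Ds [n tns]].
  - by exists n; exact: le_trans zu.
  - exists (n + m)%N; rewrite lexI (le_trans (tD n m) tz)/=.
    by rewrite addnC (le_trans (tD m n) tu).
  - have [e De te] := tS n D s dD Ds tns.
    by exists e; split=> //; exists n.+1.
have pF : F <> setT.
  move=> FT; have [n] : F \bot by rewrite FT.
  rewrite lex0 => /eqP tn; apply: (@not_way_below_bot x).
  by rewrite -tn; exact: proj2_sig (t n).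
exists (OpenFilter oF pF); split; first by exists 0%N.
by move=> z [n /(le_trans _)]; apply; apply: way_belowW; exact: proj2_sig (t n).
Qed.

End WayBelow.

Section OpenFilterSemilattice.
Context {d : Order.disp_t} {S : contSemilatticeType d}.
Implicit Types F G : open_filter S.

Lemma open_filter_inj F G : filter_set F = filter_set G -> F = G.
Proof.
case: F G => [F oF pF] [G oG pG] /= FG; move: oF pF; rewrite FG => oF pF.
by congr OpenFilter; exact: Prop_irrelevance.
Qed.

Lemma filter_proper0 F : ~ filter_set F \bot.
Proof.
move=> F0; apply: (@filter_proper _ _ F); apply/seteqP; split=> // x _.
by have [up _ _] := filter_open F; apply: up F0 (le0x x).
Qed.

Definition open_filter_le F G := `[< F `<=` G >].

Lemma open_filter_lexx : reflexive open_filter_le.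
Proof. by move=> F; apply/asboolP. Qed.

Lemma open_filter_le_anti : antisymmetric open_filter_le.
Proof.
move=> F G /andP[/asboolP FG /asboolP GF].
by apply: open_filter_inj; apply/seteqP.
Qed.

Lemma open_filter_le_trans : transitive open_filter_le.
Proof.
move=> G F H /asboolP FG /asboolP GH; apply/asboolP; exact: subset_trans GH.
Qed.

HB.instance Definition _ := gen_eqMixin (open_filter S).
HB.instance Definition _ := gen_choiceMixin (open_filter S).
HB.instance Definition _ := Order.Le_isPOrder.Build d (open_filter S)
  open_filter_lexx open_filter_le_anti open_filter_le_trans.

Lemma open_filter_leP F G : reflect (F `<=` G) (F <= G).
Proof. exact: asboolP. Qed.

Lemma set0_scott_open_filter : scott_open_filter (@set0 S).
Proof. by split. Qed.

Lemma set0_proper : @set0 S <> setT.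
Proof. by move=> /seteqP[_ /(_ \bot I)]. Qed.

Definition open_filter0 := OpenFilter set0_scott_open_filter set0_proper.

Lemma open_filter_le0x F : open_filter0 <= F.
Proof. by apply/open_filter_leP => x []. Qed.

HB.instance Definition _ :=
  Order.hasBottom.Build d (open_filter S) open_filter_le0x.

Lemma setI_scott_open_filter F G : scott_open_filter (F `&` G).
Proof.
have [upF meetF openF] := filter_open F.
have [upG meetG openG] := filter_open G.
split=> [x y [Fx Gx] xy|x y [Fx Gx] [Fy Gy]|D s D0 dD Ds [Fs Gs]].
- by split; [exact: upF Fx xy|exact: upG Gx xy].
- by split; [exact: meetF|exact: meetG].
- have [x [Dx Fx]] := openF D s D0 dD Ds Fs.
  have [y [Dy Gy]] := openG D s D0 dD Ds Gs.
  have [z [Dz xz yz]] := dD x y Dx Dy.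
  by exists z; split=> //; split; [exact: upF Fx xz|exact: upG Gy yz].
Qed.

Lemma setI_proper F G : F `&` G <> setT.
Proof. by move=> /seteqP[_ /(_ \bot I)] [/filter_proper0]. Qed.

Definition open_filterI F G :=
  OpenFilter (@setI_scott_open_filter F G) (@setI_proper F G).

Lemma open_filter_lexI F G H :
  (F <= open_filterI G H) = (F <= G) && (F <= H).
Proof.
apply/open_filter_leP/andP => [FGH|[/open_filter_leP FG /open_filter_leP FH]].
  by split; apply/open_filter_leP => x /FGH[].
by move=> x Fx; split; [exact: FG|exact: FH].
Qed.

HB.instance Definition _ := Order.POrder_isMeetSemilattice.Build d
  (open_filter S) open_filter_lexI.

Section DirectedUnion.
Variable (A : set (open_filter S)) (dA : directed A).
Let U : set S := \bigcup_(F in A) F.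

Lemma bigcup_scott_open_filter : scott_open_filter U.
Proof.
split=> [x y [F AF Fx] xy|x y [F AF Fx] [G AG Gy]|D s D0 dD Ds [F AF Fs]].
- by exists F => //; have [up _ _] := filter_open F; exact: up Fx xy.
- have [H [AH /open_filter_leP FH /open_filter_leP GH]] := dA AF AG.
  exists H => //; have [_ meet _] := filter_open H.
  by apply: meet; [exact: FH|exact: GH].
- have [_ _ /(_ D s D0 dD Ds Fs)[x [Dx Fx]]] := filter_open F.
  by exists x; split=> //; exists F.
Qed.

Lemma bigcup_proper : U <> setT.
Proof. by move=> /seteqP[_ /(_ \bot I)] [F _ /filter_proper0]. Qed.

Definition open_filterU := OpenFilter bigcup_scott_open_filter bigcup_proper.

Lemma supremums_open_filterU : supremums A open_filterU.
Proof.
split=> [F AF|G AG]; first by apply/open_filter_leP => x Fx; exists F.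
by apply/open_filter_leP => x [F /AG/open_filter_leP]; apply.
Qed.

End DirectedUnion.

Lemma open_filter_directed_supremums (A : set (open_filter S)) :
  directed A -> supremums A !=set0.
Proof.
by move=> dA; exists (open_filterU dA); exact: supremums_open_filterU.
Qed.

Let below F := [set G : open_filter S |
  exists2 x, filter_set F x & G `<=` [set z | x <= z]].

Let below_way_below F G : below F G -> way_below G F.
Proof.
move=> [x Fx Gx] D s dD Ds Fs.
have sE := is_subset1_supremums Ds (supremums_open_filterU dD).
move: Fs; rewrite sE => /open_filter_leP /(_ x Fx) [H DH Hx].
exists H => //; apply/open_filter_leP => z /Gx xz.
by have [up _ _] := filter_open H; exact: up Hx xz.
Qed.

Let mem_way_below F x : filter_set F x ->
  exists2 y, filter_set F y & way_below y x.
Proof.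
move=> Fx; have [_ _ op] := filter_open F.
have wb0 : [set y | way_below y x] !=set0.
  apply: contrapT => /set0P/negP/negPn/eqP wb0.
  apply: (@filter_proper0 F); suff <- : x = \bot by [].
  apply/eqP; rewrite -lex0.
  by apply: (supremums_way_below x).2 => y; rewrite wb0.
have [y [yx Fy]] :=
  op _ x wb0 (@directed_way_below _ _ x) (supremums_way_below x) Fx.
by exists y.
Qed.

Let mem_below F x : filter_set F x -> exists2 G, below F G & filter_set G x.
Proof.
move=> /mem_way_below[y Fy /open_filter_between[G [Gx Gy]]].
by exists G => //; exists y.
Qed.

Let directed_below F : directed (below F).
Proof.
have [up meet _] := filter_open F.
move=> G1 G2 [x1 Fx1 G1x1] [x2 Fx2 G2x2].
have [G FG Gx] := mem_below (meet x1 x2 Fx1 Fx2).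
have [upG _ _] := filter_open G.
exists G; split=> //; apply/open_filter_leP => z.
  by move=> /G1x1 xz; apply: upG Gx _; rewrite leIx2// xz.
by move=> /G2x2 xz; apply: upG Gx _; rewrite leIx2// xz orbT.
Qed.

Let supremums_below F : supremums (below F) F.
Proof.
split=> [G [x Fx Gx]|H ubH].
  apply/open_filter_leP => z /Gx xz.
  by have [up _ _] := filter_open F; exact: up Fx xz.
apply/open_filter_leP => x /mem_below[G /ubH/open_filter_leP]; exact.
Qed.

Let way_belowE F G : way_below G F -> exists2 H, below F H & G <= H.
Proof.
by move=> wb; exact: wb (@directed_below F) (@supremums_below F) (lexx F).
Qed.

Lemma open_filter_directed_way_below F : directed [set G : open_filter S | way_below G F].
Proof.
move=> G1 G2 /way_belowE[H1 FH1 GH1] /way_belowE[H2 FH2 GH2].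
have [H [FH H1H H2H]] := directed_below FH1 FH2.
exists H; split; first exact: below_way_below.
- exact: le_trans H1H.
- exact: le_trans H2H.
Qed.

Lemma open_filter_supremums_way_below F :
  supremums [set G : open_filter S | way_below G F] F.
Proof.
split=> [G /way_belowE[H FH GH]|H ubH].
  exact: le_trans GH ((supremums_below F).1 _ FH).
by apply: (supremums_below F).2 => G /below_way_below; exact: ubH.
Qed.

HB.instance Definition _ := isContinuousSemilattice.Build d (open_filter S)
  open_filter_directed_supremums open_filter_directed_way_below
  open_filter_supremums_way_below.

End OpenFilterSemilattice.

Definition sdual {d} (S : contSemilatticeType d) : contSemilatticeType d :=
  open_filter S.

Section Evaluation.
Context {d : Order.disp_t} {S : contSemilatticeType d}.
Variable s : S.

Lemma eval_scott_open_filter :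
  scott_open_filter [set F : sdual S | filter_set F s].
Proof.
split=> [F G Fs /open_filter_leP|F G Fs Gs|D F D0 dD DF Fs].
- exact.
- by split.
- move: Fs; rewrite (is_subset1_supremums DF (supremums_open_filterU dD)).
  by move=> [G DG Gs]; exists G.
Qed.

Lemma eval_proper :
  [set F : sdual S | filter_set F s] <> [set: sdual S].
Proof. by move=> /seteqP[_ /(_ open_filter0 I)]. Qed.

(* The isomorphism S -> sdual (sdual S), s |-> {F | s \in F} *)
Definition eval : sdual (sdual S) :=
  OpenFilter eval_scott_open_filter eval_proper.

End Evaluation.

Section CrispRepresentations.
Context {d : Order.disp_t}.
Implicit Types S : contSemilatticeType d.

Definition ambiguous_rep S1 S2 (R : set (S1 * S2)) :=
  [/\ forall x x' y y', R (x, y) -> x <= x' -> y' <= y -> R (x', y'),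
      forall x, [set y | R (x, y)] !=set0 &
      forall x D s, directed D -> D `<=` [set y | R (x, y)] ->
        supremums D s -> R (x, s)].

Definition pseudo_invertible S1 S2 (R : set (S1 * S2)) :=
  ambiguous_rep R /\
  forall x y y', R (x, y) -> way_below y' y ->
    exists2 x', way_below x' x & R (x', y').

Definition rep_id S : set (S * S) := [set p | p.2 <= p.1].

Definition rep_comp S1 S2 S3 (R : set (S1 * S2)) (Q : set (S2 * S3)) :
    set (S1 * S3) :=
  [set p | scott_closure [set z | exists y, R (p.1, y) /\ Q (y, z)] p.2].

Definition rep_dual S1 S2 (R : set (S1 * S2)) : set (sdual S2 * sdual S1) :=
  [set p | forall x, filter_set p.2 x ->
     exists y, R (x, y) /\ filter_set p.1 y].

End CrispRepresentations.

Section FuzzyRepresentations.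
Context {d dL : Order.disp_t} {L : cdLatticeType dL}.
Implicit Types S : contSemilatticeType d.

(* S2 *p L carries the componentwise order *)
Definition cut S1 S2 (R : set (S1 * S2 * L)) (x : S1) : set (S2 *p L) :=
  [set p | R (x, p.1, p.2)].

Definition Lambiguous_rep S1 S2 (R : set (S1 * S2 * L)) :=
  [/\ forall x x' y y' a a',
        R (x, y, a) -> x <= x' -> y' <= y -> a' <= a -> R (x', y', a'),
      forall x, [/\ scott_closed (cut R x), forall a, R (x, \bot, a) &
                    forall y, R (x, y, \bot)] &
      forall x y a b, R (x, y, a) -> R (x, y, b) -> R (x, y, (a `|` b)%O)].

Definition Lrep_dual S1 S2 (R : set (S1 * S2 * L)) :
    set (sdual S2 * sdual S1 * L) :=
  [set p | forall b x, way_below b p.2 -> filter_set p.1.2 x ->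
     exists y, R (x, y, b) /\ filter_set p.1.1 y].

Definition bidual_pullback S1 S2
    (R : set (sdual (sdual S1) * sdual (sdual S2) * L)) : set (S1 * S2 * L) :=
  [set p | R (eval p.1.1, eval p.1.2, p.2)].

Definition Lpseudo_invertible S1 S2 (R : set (S1 * S2 * L)) :=
  Lambiguous_rep R /\ bidual_pullback (Lrep_dual (Lrep_dual R)) = R.

Definition Lrep_star (star : L -> L -> L) S1 S2 S3
    (R : set (S1 * S2 * L)) (Q : set (S2 * S3 * L)) : set (S1 * S3 * L) :=
  [set p | p.2 <= lub [set a | exists y b c,
     [/\ R (p.1.1, y, b), Q (y, p.1.2, c) & a = star b c]]].

Definition Lrep_comp (star : L -> L -> L) S1 S2 S3
    (R : set (S1 * S2 * L)) (Q : set (S2 * S3 * L)) : set (S1 * S3 * L) :=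
  [set p | scott_closure (cut (Lrep_star star R Q) p.1.1) (p.1.2, p.2)].

Definition rep_embed S1 S2 (R : set (S1 * S2)) : set (S1 * S2 * L) :=
  [set p | R p.1 \/ p.2 = \bot].

End FuzzyRepresentations.

(* Arrows a b is a type containing the arrows from a to b, which are singled
   out by is_arrow; composition is in diagrammatic order. *)
Record category_data := CategoryData {
  object :> Type;
  arrow : object -> object -> Type;
  is_arrow : forall a b, arrow a b -> Prop;
  idarr : forall a, arrow a a;
  comp : forall a b c, arrow a b -> arrow b c -> arrow a c
}.
Arguments is_arrow {C a b} f : rename.
Arguments idarr {C} a : rename.
Arguments comp {C a b c} f g : rename.

Definition is_category (C : category_data) :=
  [/\ forall a : C, is_arrow (idarr a),
      forall (a b c : C) (f : arrow a b) (g : arrow b c),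
        is_arrow f -> is_arrow g -> is_arrow (comp f g),
      forall (a b : C) (f : arrow a b),
        is_arrow f -> comp (idarr a) f = f /\ comp f (idarr b) = f &
      forall (a b c e : C) (f : arrow a b) (g : arrow b c) (h : arrow c e),
        is_arrow f -> is_arrow g -> is_arrow h ->
        comp (comp f g) h = comp f (comp g h)].

Record functor_data (C D : category_data) := FunctorData {
  fobj :> C -> D;
  farr : forall a b : C, arrow a b -> arrow (fobj a) (fobj b)
}.
Arguments farr {C D} F {a b} f : rename.

Record contravariant_data (C D : category_data) := ContravariantData {
  cobj :> C -> D;
  carr : forall a b : C, arrow a b -> arrow (cobj b) (cobj a)
}.
Arguments carr {C D} F {a b} f : rename.

Definition is_contravariant_functor C D (F : contravariant_data C D) :=
  [/\ is_category C /\ is_category D,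
      forall (a b : C) (f : arrow a b), is_arrow f -> is_arrow (carr F f),
      forall a : C, carr F (idarr a) = idarr (F a) &
      forall (a b c : C) (f : arrow a b) (g : arrow b c),
        is_arrow f -> is_arrow g ->
        carr F (comp f g) = comp (carr F g) (carr F f)].

Definition id_functor (C : category_data) : functor_data C C :=
  @FunctorData C C id (fun a b f => f).

(* First F, then G *)
Definition contravariant_comp C D E
    (F : contravariant_data C D) (G : contravariant_data D E) :
    functor_data C E :=
  @FunctorData C E (fun a => G (F a)) (fun a b f => carr G (carr F f)).

Definition is_isomorphism (C : category_data) (a b : C) (f : arrow a b) :=
  is_arrow f /\
  exists g : arrow b a, [/\ is_arrow g, comp f g = idarr a & comp g f = idarr b].

Definition naturally_isomorphic C D (F G : functor_data C D) :=
  exists eta : forall a : C, arrow (F a) (G a),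
    (forall a, is_isomorphism (eta a)) /\
    (forall (a b : C) (f : arrow a b), is_arrow f ->
       comp (farr F f) (eta b) = comp (eta a) (farr G f)).

Definition SemPR (d : Order.disp_t) : category_data := {|
  object := contSemilatticeType d;
  arrow := fun S1 S2 => set (S1 * S2);
  is_arrow := fun S1 S2 R => pseudo_invertible R;
  idarr := fun S => @rep_id d S;
  comp := fun S1 S2 S3 R Q => rep_comp R Q
|}.

Section FuzzyCategory.
Context (d : Order.disp_t) {dL : Order.disp_t} {L : cdLatticeType dL}.
Variable star : L -> L -> L.

Definition SemPRL : category_data := {|
  object := contSemilatticeType d;
  arrow := fun S1 S2 => set (S1 * S2 * L);
  is_arrow := fun S1 S2 R => Lpseudo_invertible R;
  idarr := fun S => rep_embed (@rep_id d S);
  comp := fun S1 S2 S3 R Q => Lrep_comp star R Q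
|}.

Definition embedding : functor_data (SemPR d) SemPRL :=
  @FunctorData (SemPR d) SemPRL id (fun S1 S2 R => rep_embed R).

End FuzzyCategory.

Definition duality (d : Order.disp_t) :
    contravariant_data (SemPR d) (SemPR d) :=
  @ContravariantData (SemPR d) (SemPR d) sdual (fun S1 S2 R => rep_dual R).

Definition Lduality (d : Order.disp_t) {dL : Order.disp_t}
    {L : cdLatticeType dL} (star star' : L -> L -> L) :
    contravariant_data (SemPRL d star) (SemPRL d star') :=
  @ContravariantData (SemPRL d star) (SemPRL d star') sdual
    (fun S1 S2 R => Lrep_dual R).

(* Main.v *)
Require Import Defs.
From mathcomp Require Import all_boot all_order.
From mathcomp Require Import boolp classical_sets.

(* With [b <| a] ([totally_below]: every family whose join dominates [a] has a
   member above [b]), the pseudo-invertible relations turn out to be exactly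
   those [R] for which
     R (x, y, a) <-> for all y' << y and b <| a there is x' << x
                     with R (x', y', b).
   Working with [<|] rather than [<<] on L removes both the suprema and the
   Scott closure from the composition: (x, z, a) is in the composite of R and Q
   iff for all z' << z and a' <| a there are y, b, c with R (x, y, b),
   Q (y, z', c) and a' <= b * c. Associativity and compatibility with the
   duality then follow by interpolation, as a' <| b * c forces a' <= b' * c' for
   some b' <| b and c' <| c. The natural isomorphism comes from the
   order isomorphism of S with its bidual. *)

Set Implicit Arguments.
Unset Strict Implicit.
Unset Printing Implicit Defensive.

Import Order.Theory.
Local Open Scope order_scope.
Local Open Scope classical_set_scope.

(** * Complete distributivity and the totally below relation *)

Section TotallyBelow.
Context {d : Order.disp_t} {L : cdLatticeType d}.
Implicit Types (A : set L) (a b c : L).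

Lemma lub_supremums A : supremums A (lub A).
Proof.
rewrite /lub /supremum; case: eqVneq => [->|_]; last first.
  by have [x Ax] := supremums_neq0 A; case: xgetP => // /(_ x).
by split=> // x _; exact: le0x.
Qed.

Lemma lub_ub A a : A a -> a <= lub A.
Proof. exact: (lub_supremums A).1. Qed.

Lemma lub_le A a : (forall b, A b -> b <= a) -> lub A <= a.
Proof. exact: (lub_supremums A).2. Qed.

Lemma lub_pair b c : b <= c -> lub [set b; c] = c.
Proof.
move=> bc; apply/le_anti/andP; split; last by apply: lub_ub; right.
by apply: lub_le => x [->|->].
Qed.

Lemma glb_infimums A : infimums A (glb A).
Proof.
rewrite /glb /infimum; case: eqVneq => [->|_].
  by split=> // x _; exact: lex1.
have Ainf : infimums A (lub (lbound A)).
  split=> [x Ax|x]; last exact: lub_ub.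
  by apply: lub_le => b; apply.
by case: xgetP => // /(_ _ Ainf).
Qed.

Definition totally_below b a :=
  forall A, a <= lub A -> exists2 e, A e & b <= e.

(** Apply distributivity to the family of all [A] whose join dominates [a]. A choice function [s]
    picks a member of each such [A], so the meet of its values lies below some member of every [A],
    hence is totally below [a]. *)
Lemma lub_totally_below a : a <= lub [set b | totally_below b a].
Proof.
pose I := {A : set L | a <= lub A}; pose J (i : I) := {x : L | sval i x}.
pose f (i : I) (j : J i) : L := sval j.
have : a <= glb [set lub (range (f i)) | i in [set: I]].
  apply: (glb_infimums _).2 => _ [[A aA] _ <-].
  apply: (le_trans (y := lub A)) => //; apply: lub_le => b Ab.
  by apply: lub_ub; exists (exist _ b Ab).
rewrite glb_lub_distr => /le_trans; apply; apply: lub_le => _ [s _ <-].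
apply: lub_ub => A aA; exists (f _ (s (exist _ A aA))).
  exact: (svalP (s (exist _ A aA))).
by apply: (glb_infimums _).1; exists (exist _ A aA).
Qed.

Lemma le_totally_below a c :
  (forall b, totally_below b a -> b <= c) -> a <= c.
Proof. by move=> ac; apply: le_trans (lub_totally_below a) (lub_le ac). Qed.

Lemma totally_below_le b b' a' a :
  b <= b' -> totally_below b' a' -> a' <= a -> totally_below b a.
Proof.
move=> bb' ba' aa' A aA; have [e Ae b'e] := ba' A (le_trans aa' aA).
by exists e => //; exact: le_trans b'e.
Qed.

Lemma totally_below_way_below b a : totally_below b a -> way_below b a.
Proof.
move=> ba D s dD Ds ays; apply: ba; apply: le_trans ays _.
by apply: Ds.2 => x; exact: lub_ub.
Qed.

Lemma totally_belowW b a : totally_below b a -> b <= a.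
Proof.
by move=> /(_ [set a])[|e -> //]; apply: lub_ub.
Qed.

Lemma not_totally_below_bot b : ~ totally_below b \bot.
Proof. by move=> /(_ set0)[|e []]; exact: le0x. Qed.

Lemma totally_below_interpolation b a :
  totally_below b a -> exists2 c, totally_below b c & totally_below c a.
Proof.
move=> /(_ [set e | exists2 c, totally_below e c & totally_below c a]).
case=> [|e [c ec ca] be]; last first.
  by exists c => //; exact: totally_below_le ec (lexx _).
apply: le_totally_below => c ca; apply: le_totally_below => e ec.
by apply: lub_ub; exists c.
Qed.

Lemma totally_below_neq0 a :
  a <> \bot -> exists2 b, totally_below b a & b <> \bot.
Proof.
move=> a0; apply: contrapT => nb; apply: a0; apply/eqP; rewrite -lex0.
apply: le_totally_below => b ba; rewrite lex0; apply/eqP.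
by apply: contrapT => b0; apply: nb; exists b.
Qed.

(** This is the bridge from [totally_below] to [way_below]: such a [J] is directed and its join
    dominates [a]. It may be empty, as the empty set counts as directed. *)
Lemma way_below_ideal (J : set L) b a :
  (forall x y, J y -> x <= y -> J x) ->
  (forall x y, J x -> J y -> J (x `|` y)%O) ->
  (forall c, totally_below c a -> J c) -> way_below b a -> J b.
Proof.
move=> downJ joinJ aJ ba.
have [|||e Je be] := ba J (lub J); last exact: downJ be.
- move=> x y Jx Jy; exists (x `|` y)%O.
  by split; [exact: joinJ|exact: leUl|exact: leUr].
- exact: lub_supremums.
- by apply: le_totally_below => c /aJ; exact: lub_ub.
Qed.

End TotallyBelow.

(** * Monotonicity and approximation of the quantale operation *)

Section Quantale.
Context {d : Order.disp_t} {L : cdLatticeType d}.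
Variable star : L -> L -> L.
Hypothesis hstar : unital_quantale star.

Lemma opp_star_unital_quantale : unital_quantale (opp_star star).
Proof.
case: hstar => sA sl sr s1 s1'; split=> // [a b c|A b|a B].
- by rewrite /opp_star sA.
- exact: sr.
- exact: sl.
Qed.

Lemma star_le a a' b b' : a <= a' -> b <= b' -> star a b <= star a' b'.
Proof.
move=> aa' bb'; apply: (@le_trans _ _ (star a b')).
  rewrite -(lub_pair bb') star_lubr //.
  by apply: lub_ub; exists b => //; left.
rewrite -(lub_pair aa') star_lubl //.
by apply: lub_ub; exists a => //; left.
Qed.

Lemma star_lel a b : star a b <= a.
Proof. by rewrite -{2}(starx1 hstar a) star_le ?lex1. Qed.

Lemma star_ler a b : star a b <= b.
Proof. by rewrite -{2}(star1x hstar b) star_le ?lex1. Qed.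

(** Each factor is the join of the elements totally below it, and [star] distributes over these
    joins. The factors are shrunk one at a time, the interpolant [m] leaving room for the second. *)
Lemma totally_below_star a b c : totally_below a (star b c) ->
  exists b' c', [/\ totally_below b' b, totally_below c' c & a <= star b' c'].
Proof.
move=> /totally_below_interpolation[m am mbc].
have [|_ [b' b'b <-] mb'] := mbc [set star b' c | b' in totally_below^~ b].
  rewrite -star_lubl //; apply: star_le => //; exact: lub_totally_below.
have [|_ [c' c'c <-] ac'] := am [set star b' c' | c' in totally_below^~ c].
  rewrite -star_lubr //; apply: le_trans mb' _.
  apply: star_le => //; exact: lub_totally_below.
by exists b', c'.
Qed.

End Quantale.

(** * Scott open filters and their way-below relation *)

Section OpenFilters.
Context {d : Order.disp_t} {S : contSemilatticeType d}.
Implicit Types (F G : open_filter S) (x y z : S).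

Lemma open_filter_up F x y : filter_set F x -> x <= y -> filter_set F y.
Proof. by case: (filter_open F) => up _ _; exact: up. Qed.

Lemma le_way_below y z : (forall x, way_below x y -> x <= z) -> y <= z.
Proof. exact: (supremums_way_below y).2. Qed.

(** Non-emptiness of [D] is automatic: otherwise [s] would be [\bot], which lies in no proper
    filter. *)
Lemma open_filter_meets F D s : directed D -> supremums D s ->
  filter_set F s -> D `&` F !=set0.
Proof.
move=> dD Ds Fs; have [_ _] := filter_open F; apply; last exact: Fs; [|by []..].
apply: contrapT => /set0P/negP/negPn/eqP D0; apply: (@filter_proper0 _ _ F).
by apply: open_filter_up Fs _; apply: Ds.2; rewrite D0.
Qed.

Lemma open_filter_way_below F x : filter_set F x ->
  exists2 y, filter_set F y & way_below y x.
Proof.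
move=> /(open_filter_meets (@directed_way_below _ _ x)
  (supremums_way_below x))[y [yx Fy]].
by exists y.
Qed.

Lemma way_below_open_filter F G x :
  filter_set F x -> G `<=` [set z | x <= z] -> way_below G F.
Proof.
move=> Fx Gx D s dD Ds /open_filter_leP/(_ x Fx).
rewrite (is_subset1_supremums Ds (supremums_open_filterU dD)) => -[H DH Hx].
by exists H => //; apply/open_filter_leP => z /Gx; exact: open_filter_up.
Qed.

Lemma open_filter_basis F x : filter_set F x ->
  exists2 G : open_filter S, way_below G F & filter_set G x.
Proof.
move=> /open_filter_way_below[y Fy /open_filter_between[G [Gx Gy]]].
by exists G => //; exact: way_below_open_filter Gy.
Qed.

(** The open filters bounded below by some member of [F] form a directed family with supremum [F].
    Directedness comes from interpolating an open filter below the meet of two such bounds. *)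
Lemma way_below_open_filterE F G : way_below G F ->
  exists2 x, filter_set F x & G `<=` [set z | x <= z].
Proof.
have [_ meet _] := filter_open F.
move=> /(_ [set H : open_filter S |
  exists2 x, filter_set F x & H `<=` [set z | x <= z]] F).
case=> [H1 H2 [x1 Fx1 H1x1] [x2 Fx2 H2x2]| | |H [x Fx Hx] /open_filter_leP GH].
- have [z Fz zx] := open_filter_way_below (meet _ _ Fx1 Fx2).
  have [H [Hx Hz]] := open_filter_between zx.
  exists H; split; first by exists z.
    apply/open_filter_leP => u /H1x1 xu.
    by apply: open_filter_up Hx _; rewrite leIx2// xu.
  apply/open_filter_leP => u /H2x2 xu.
  by apply: open_filter_up Hx _; rewrite leIx2// xu orbT.
- split=> [H [x Fx Hx]|H ubH].
    apply/open_filter_leP => u /Hx; exact: open_filter_up.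
  apply/open_filter_leP => x /open_filter_way_below[y Fy].
  move=> /open_filter_between[K [Kx Ky]].
  by have /open_filter_leP : K <= H by [apply: ubH; exists y]; exact.
- exact: lexx.
- by exists x => // z /GH/Hx.
Qed.

End OpenFilters.

(** * The order isomorphism between a semilattice and its bidual *)

Section Evaluation.
Context {d : Order.disp_t} {S : contSemilatticeType d}.
Implicit Types (x y z : S) (X : sdual (sdual S)).

(** Open filters separate points: if [z] is way below [x], an open filter between them contains [x],
    hence [y], and all its members lie above [z]. *)
Lemma eval_leE x y : (eval x <= eval y) = (x <= y).
Proof.
apply/idP/idP => [/open_filter_leP xy|xy]; last first.
  by apply/open_filter_leP => F /= Fx; exact: open_filter_up Fx xy.
apply: le_way_below => z /open_filter_between[F [Fx Fz]].
exact: Fz (xy F Fx).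
Qed.

(** The preimage is the supremum of all lower bounds of members of [X]. These are directed because
    [X] is closed under meets and each of its members contains such a bound. *)
Lemma eval_surj X : exists x, eval x = X.
Proof.
pose D := [set x | exists2 F : sdual S,
  filter_set X F & F `<=` [set z | x <= z]].
have small F : filter_set X F -> exists2 x, filter_set F x & D x.
  move=> /open_filter_way_below[G XG /way_below_open_filterE[x Fx Gx]].
  by exists x => //; exists G.
have dD : directed D.
  move=> x y [F XF Fx] [G XG Gy].
  have [_ meet _] := filter_open X.
  have [z [/Fx xz /Gy yz] Dz] := small _ (meet F G XF XG).
  by exists z.
have [s Ds] := directed_supremums _ dD.
exists s; apply: open_filter_inj; apply/seteqP; split=> F /= => [Fs|XF].
  have [x [[G XG Gx] Fx]] := open_filter_meets dD Ds Fs.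
  apply: open_filter_up XG _; apply/open_filter_leP => z /Gx.
  exact: open_filter_up.
have [x Fx Dx] := small F XF.
by apply: open_filter_up Fx _; exact: Ds.1.
Qed.

Definition uneval X : S := projT1 (cid (eval_surj X)).

Lemma unevalK X : eval (uneval X) = X.
Proof. by rewrite /uneval; case: cid. Qed.

Lemma evalK x : uneval (eval x) = x.
Proof. by apply/le_anti; rewrite -!eval_leE unevalK lexx. Qed.

Lemma le_uneval x X : (x <= uneval X) = (eval x <= X).
Proof. by rewrite -eval_leE unevalK. Qed.

Lemma uneval_le x X : (uneval X <= x) = (X <= eval x).
Proof. by rewrite -eval_leE unevalK. Qed.

End Evaluation.

(** A lower adjoint preserves suprema, so [l x] is the directed supremum of the [l x'] with [x'] way
    below [x]. *)
Lemma adjoint_way_below {d} {S1 S2 : contSemilatticeType d}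
    {l : S1 -> S2} {r : S2 -> S1} : (forall x z, (l x <= z) = (x <= r z)) ->
  forall x z, way_below z (l x) -> exists2 x', way_below x' x & z <= l x'.
Proof.
move=> lr x z.
have lle u v : u <= v -> l u <= l v.
  by move=> uv; rewrite lr (le_trans uv)// -lr.
move=> /(_ [set l x' | x' in way_below^~ x] (l x)).
case=> [_ _ [u ux <-] [v vx <-]| | |_ [x' x'x <-] zx']; last by exists x'.
- have [w [wx uw vw]] := directed_way_below _ _ _ ux vx.
  by exists (l w); split; [exists w|exact: lle|exact: lle].
- split=> [_ [u /way_belowW ux <-]|u ub]; first exact: lle.
  rewrite lr; apply: le_way_below => v vx; rewrite -lr; apply: ub.
  by exists v.
- exact: lexx.
Qed.

(** * Regular relations and their identification with pseudo-invertible ones *)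

Section RegularRelations.
Context {d dL : Order.disp_t} {L : cdLatticeType dL}.
Implicit Types (S : contSemilatticeType d).

Definition regular S1 S2 (R : set (S1 * S2 * L)) := forall x y a,
  R (x, y, a) <-> forall y' b, way_below y' y -> totally_below b a ->
    exists2 x', way_below x' x & R (x', y', b).

Lemma rep_le S1 S2 (R : set (S1 * S2 * L)) x x' y y' a a' :
  Lambiguous_rep R -> R (x, y, a) -> x <= x' -> y' <= y -> a' <= a ->
  R (x', y', a').
Proof. by case=> le _ _; exact: le. Qed.

(** Nothing is way below [y] when [y] is [\bot]. Adding [(\bot, a)] to the approximating set keeps
    it non-empty, so that its supremum has second component [a]. *)
Lemma scott_closed_botr S (A : set (S *p L)) y a : scott_closed A ->
  A (\bot, a) -> (forall y', way_below y' y -> A (y', a)) -> A (y, a).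
Proof.
move=> [_ Asup] A0 Ay.
pose D := [set p : S *p L | (p.1 = \bot \/ way_below p.1 y) /\ p.2 = a].
apply: (Asup D).
- move=> [y1 a1] [y2 a2] [/= H1 ->] [/= H2 ->].
  case: H1 => [->|H1].
    by exists (y2, a); split; rewrite ?leEprod/= ?le0x ?lexx.
  case: H2 => [->|H2].
    exists (y1, a); split; rewrite ?leEprod/= ?le0x ?lexx //.
    by split=> //; right.
  have [z [zy y1z y2z]] := directed_way_below _ _ _ H1 H2.
  exists (z, a); split; rewrite ?leEprod/= ?y1z ?y2z ?lexx //.
  by split=> //; right.
- by move=> [y' _] [/= + ->] => -[->|/Ay].
- split=> [[y' _] [/= + ->]|[u c] ub].
    by rewrite leEprod/= lexx andbT => -[->|/way_belowW]; rewrite ?le0x.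
  have /andP[_ /= ac] : (\bot : S, a) <= (u, c) :> (S *p L).
    by apply: ub; split=> //; left.
  rewrite leEprod/= ac andbT; apply: le_way_below => y' y'y.
  by have /andP[] : (y', a) <= (u, c) :> (S *p L) by apply: ub; split=> //; right.
Qed.

(** One approximation condition replaces clauses (b) and (c). It yields the zero clauses vacuously,
    and closure under joins because an element totally below a binary join is below one of the two
    terms. *)
Lemma Lambiguous_repP S1 S2 (R : set (S1 * S2 * L)) : Lambiguous_rep R <->
  (forall x x' y y' a a',
     R (x, y, a) -> x <= x' -> y' <= y -> a' <= a -> R (x', y', a')) /\
  (forall x y a, (forall y' b, way_below y' y -> totally_below b a ->
     R (x, y', b)) -> R (x, y, a)).
Proof.
split=> [[le cutR joinR]|[le supR]]; split=> //.
- move=> x y a Ra; have [scR R0y R0a] := cutR x.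
  suff: cut R x (y, a) by [].
  apply: (scott_closed_botr scR) => [|y' y'y]; first exact: R0y.
  have [_ Rsup] := scR.
  (* Clause (c) makes [D] directed. It contains [(y', b)] for every [b] totally below [a], and the
     bound by [a] makes its supremum exactly [(y', a)]. *)
  pose D := [set p : S2 *p L | p.1 = y' /\ R (x, y', p.2) /\ p.2 <= a].
  apply: (Rsup D) => [|[u c] [/= -> []] //|].
    move=> [y1 a1] [y2 a2] [/= -> [R1 a1a]] [/= -> [R2 a2a]].
    exists (y', a1 `|` a2)%O.
    split; rewrite ?leEprod/= ?lexx ?leUl ?leUr //; split=> //.
    by rewrite leUx a1a a2a; split=> //; exact: joinR.
  split=> [[u c] [/= -> [_ ca]]|[u c] ub].
    by rewrite leEprod/= lexx ca.
  have /andP[/= y'u _] : (y', \bot : L) <= (u, c) :> (S2 *p L).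
    by apply: ub; split=> //=.
  rewrite leEprod/= y'u/=; apply: le_totally_below => b ba.
  have /andP[] // : (y', b) <= (u, c) :> (S2 *p L).
  by apply: ub; split=> //; split; [exact: Ra|exact: totally_belowW].
- move=> x; split=> [|a|y].
  + split=> [[y a] [z b] Rzb /andP[/= yz ab]|D [y a] dD DR Ds].
      exact: le Rzb _ yz ab.
    apply: supR => y' b y'y ba.
    (* Suprema in the product are componentwise, so the projections of [D] are directed with suprema
       [y] and [a]. An upper bound in [D] of the two witnesses then dominates [(y', b)]. *)
    have [|||_ [p Dp <-] y'p] := y'y [set p.1 | p in D] y.
    * move=> _ _ [p Dp <-] [q Dq <-]; have [r [Dr pr qr]] := dD p q Dp Dq.
      exists r.1; split; first by exists r.
        by case/andP: pr.
      by case/andP: qr.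
    * split=> [_ [p /Ds.1/andP[] + _ <-] //|u ub].
      have /andP[] // : (y, a) <= (u, a) :> (S2 *p L).
      apply: Ds.2 => p Dp; rewrite leEprod /= ub /=; last by exists p.
      by case/andP: (Ds.1 p Dp).
    * exact: lexx.
    have [|||_ [q Dq <-] bq] := totally_below_way_below ba
      (D := [set p.2 | p in D]) (s := a).
    * move=> _ _ [r Dr <-] [q Dq <-]; have [t [Dt rt qt]] := dD r q Dr Dq.
      exists t.2; split; first by exists t.
        by case/andP: rt.
      by case/andP: qt.
    * split=> [_ [r /Ds.1/andP[] _ + <-] //|u ub].
      have /andP[] // : (y, a) <= (y, u) :> (S2 *p L).
      apply: Ds.2 => r Dr; rewrite leEprod /= ub /= ?andbT; last by exists r.
      by case/andP: (Ds.1 r Dr).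
    * exact: lexx.
    have [[u c] [Du /andP[pu _] /andP[_ qu]]] := dD p q Dp Dq.
    by apply: le (DR _ Du) _ _ _ => //; [exact: le_trans pu|exact: le_trans qu].
  + by apply: supR => y' b /not_way_below_bot.
  + by apply: supR => y' b _ /not_totally_below_bot.
- move=> x y a b Ra Rb; apply: supR => y' c /way_belowW y'y cab.
  have [|_ [->|->] ce] := cab [set a; b].
  + by rewrite leUx !lub_ub //; [right|left].
  + exact: le Ra _ y'y ce.
  + exact: le Rb _ y'y ce.
Qed.

Lemma rep_sup S1 S2 (R : set (S1 * S2 * L)) x y a : Lambiguous_rep R ->
  (forall y' b, way_below y' y -> totally_below b a -> R (x, y', b)) ->
  R (x, y, a).
Proof. by case/Lambiguous_repP => _; apply. Qed.

Lemma regular_ambiguous S1 S2 (R : set (S1 * S2 * L)) :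
  regular R -> Lambiguous_rep R.
Proof.
move=> rR; apply/Lambiguous_repP; split.
  move=> x x' y y' a a' Ra xx' y'y a'a.
  apply/rR => z b zy' ba'; have /rR/(_ z b)[||u ux Ru] := Ra.
  - exact: way_below_le zy' y'y.
  - exact: totally_below_le ba' a'a.
  - by exists u => //; exact: way_below_le ux xx'.
move=> x y a Ra; apply/rR => y' b /way_below_interpolation[z y'z zy].
move=> /totally_below_interpolation[c bc ca].
by have /rR := Ra z c zy ca; apply.
Qed.

(** For fixed [x] and [G], the admissible degrees form an ideal: [G] is closed under meets, and
    clause (c) joins the degrees at the meet of two witnesses. Hence [way_below_ideal] applies. *)
Lemma Lrep_dualE S1 S2 (R : set (S1 * S2 * L)) G F a : Lambiguous_rep R ->
  Lrep_dual R (G, F, a) <->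
  forall b x, totally_below b a -> filter_set F x ->
    exists y, R (x, y, b) /\ filter_set G y.
Proof.
move=> aR; split=> [RGF b x /totally_below_way_below|RGF b x ba Fx].
  exact: RGF.
apply: (way_below_ideal (J := [set b | exists y, R (x, y, b) /\ filter_set G y])
  (a := a)) => //.
- move=> b1 b2 [y [Ry Gy]] le12; exists y; split=> //.
  exact: rep_le Ry _ _ _.
- move=> b1 b2 [y1 [Ry1 Gy1]] [y2 [Ry2 Gy2]]; exists (y1 `&` y2)%O.
  have [_ meet _] := filter_open G; split; last exact: meet.
  case: aR => le _; apply.
    by apply: le Ry1 _ _ _ => //; exact: leIl.
  by apply: le Ry2 _ _ _ => //; exact: leIr.
- by move=> c ca; exact: RGF.
Qed.

(** A filter [F'] way below [F] is bounded below by a single [x] in [F], so one witness [y] for [x]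
    serves all of [F'], and [G'] can be taken as any open filter way below [G] that contains [y]. *)
Lemma regular_dual S1 S2 (R : set (S1 * S2 * L)) :
  Lambiguous_rep R -> regular (Lrep_dual R).
Proof.
move=> aR G F a; split=> [/(Lrep_dualE _ _ _ aR) RGF F' b|RGF].
  move=> /way_below_open_filterE[x Fx F'x] /totally_below_interpolation[c bc ca].
  have [y [Rxy Gy]] := RGF c x ca Fx.
  have [y' Gy' y'y] := open_filter_way_below Gy.
  have [G' [G'y G'y']] := open_filter_between y'y.
  exists G'; first exact: way_below_open_filter G'y'.
  apply/Lrep_dualE => // e u eb /F'x xu; exists y; split=> //.
  apply: rep_le Rxy xu (lexx y) _ => //.
  exact: le_trans (totally_belowW eb) (totally_belowW bc).
apply/Lrep_dualE => // b x /totally_below_interpolation[c bc ca].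
move=> /open_filter_basis[F' F'F F'x].
have [G' /way_belowW/open_filter_leP G'G /(Lrep_dualE _ _ _ aR) RGF'] :=
  RGF F' c F'F ca.
by have [y [Rxy /G'G Gy]] := RGF' b x bc F'x; exists y.
Qed.

(** Every open filter containing a point contains an element way below it, and conversely fits above
    any such element for a suitable choice of filter. Quantifiers over filters thus become
    quantifiers over points way below, once for [y] and once for [x]. *)
Lemma bidualE S1 S2 (R : set (S1 * S2 * L)) x y a : Lambiguous_rep R ->
  bidual_pullback (Lrep_dual (Lrep_dual R)) (x, y, a) <->
  forall y' b, way_below y' y -> totally_below b a ->
    exists2 x', way_below x' x & R (x', y', b).
Proof.
move=> aR; have aR' := regular_ambiguous (regular_dual aR).
split=> [/(Lrep_dualE _ _ _ aR') Rxy y' b|Rxy].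
  move=> /open_filter_between[G [Gy Gy']] /totally_below_interpolation[c bc ca].
  have [F [/(Lrep_dualE _ _ _ aR) RGF Fx]] := Rxy c G ca Gy.
  have [x' Fx' x'x] := open_filter_way_below (Fx : filter_set F x).
  have [u [Ru /Gy' y'u]] := RGF b x' bc Fx'.
  by exists x' => //; exact: rep_le Ru _ _ _.
apply/Lrep_dualE => // b G ba Gy.
have [y' Gy' y'y] := open_filter_way_below (Gy : filter_set G y).
have [x' x'x Rx'] := Rxy y' b y'y ba.
have [F [Fx Fx']] := open_filter_between x'x.
exists F; split=> //; apply/Lrep_dualE => // c u cb /Fx' x'u.
exists y'; split=> //; apply: rep_le Rx' x'u _ _ => //.
exact: totally_belowW.
Qed.

Lemma Lpseudo_invertibleP S1 S2 (R : set (S1 * S2 * L)) :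
  Lpseudo_invertible R <-> regular R.
Proof.
split=> [[aR RE] x y a|rR]; first by rewrite -(bidualE _ _ _ aR) RE.
have aR := regular_ambiguous rR; split=> //.
apply/seteqP; split=> -[[x y] a] /=.
  by move=> /(bidualE _ _ _ aR)/rR.
by move=> /rR/(bidualE _ _ _ aR).
Qed.

(** * Composition of regular relations *)

Section Composition.
Variable star : L -> L -> L.
Hypothesis hstar : unital_quantale star.

(** The right-hand side defines a relation [T] with Scott closed cuts. It contains
    [Lrep_star star R Q], since an element totally below a join is below one of its terms.
    Conversely, [T] lies in any Scott closed superset by [scott_closed_botr]. *)
Lemma Lrep_compE S1 S2 S3 (R : set (S1 * S2 * L)) (Q : set (S2 * S3 * L)) x z a :
  Lambiguous_rep R -> Lambiguous_rep Q ->
  Lrep_comp star R Q (x, z, a) <->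
  forall z' a', way_below z' z -> totally_below a' a ->
    exists y b c, [/\ R (x, y, b), Q (y, z', c) & a' <= star b c].
Proof.
move=> aR aQ.
pose T := [set p : S1 * S3 * L | forall z' a',
  way_below z' p.1.2 -> totally_below a' p.2 ->
  exists y b c, [/\ R (p.1.1, y, b), Q (y, z', c) & a' <= star b c]].
have aT : Lambiguous_rep T.
  apply/Lambiguous_repP; split.
    move=> u u' v v' e e' Tu uu' v'v e'e w f /= wv fe.
    have [||y [b [c [Rb Qc fbc]]]] := Tu w f.
    - exact: way_below_le wv v'v.
    - exact: totally_below_le fe e'e.
    by exists y, b, c; split=> //; exact: rep_le Rb _ _ _.
  move=> u v e Tu w f /way_below_interpolation[w' ww' w'v].
  by move=> /totally_below_interpolation[f' ff' f'e]; exact: (Tu w' f').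
split=> [|Txz].
  have [_ /(_ x)[scT _ _] _] := aT.
  apply: (smallest_sub scT) => -[u e] /= ule z' a' z'u a'e.
  have [_ [y [b [c [Rb Qc ->]]]] a'bc] := a'e _ ule.
  exists y, b, c; split=> //.
  exact: rep_le Qc (lexx _) (way_belowW z'u) (lexx _).
move=> A [scA RQA]; apply: (scott_closed_botr scA) => [|z' z'z]; apply: RQA.
  (* At [\bot] every degree is reached: the zero clauses provide degree [\top] in both factors
     through the middle element [\bot]. *)
  rewrite /cut /=; apply: (@le_trans _ _ (star \top \top)).
    by rewrite (star1x hstar) lex1.
  apply: lub_ub; exists \bot, \top, \top; split=> //.
    by case: aR => _ /(_ x)[].
  by case: aQ => _ /(_ \bot)[].
rewrite /cut/=; apply: le_totally_below => a' a'a.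
have [y [b [c [Rb Qc a'bc]]]] := Txz z' a' z'z a'a.
by apply: le_trans a'bc _; apply: lub_ub; exists y, b, c.
Qed.

Lemma mem_Lrep_comp S1 S2 S3 (R : set (S1 * S2 * L)) (Q : set (S2 * S3 * L))
    x y z b c : Lambiguous_rep R -> Lambiguous_rep Q ->
  R (x, y, b) -> Q (y, z, c) -> Lrep_comp star R Q (x, z, star b c).
Proof.
move=> aR aQ Rb Qc; apply/Lrep_compE => // z' a' /way_belowW z'z.
move=> /totally_belowW a'bc; exists y, b, c; split=> //.
exact: rep_le Qc _ _ _.
Qed.

Lemma regular_comp S1 S2 S3 (R : set (S1 * S2 * L)) (Q : set (S2 * S3 * L)) :
  regular R -> regular Q -> regular (Lrep_comp star R Q).
Proof.
move=> rR rQ; have aR := regular_ambiguous rR; have aQ := regular_ambiguous rQ.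
move=> x z a; split=> [/(Lrep_compE _ _ _ aR aQ) Tz z' a'|Tz].
  (* One interpolation step is spent on unfolding the composite, the other on splitting the product
     and pulling [z'] back through [Q] and then [R]. *)
  move=> /way_below_interpolation[v z'v vz].
  move=> /totally_below_interpolation[m a'm ma].
  have [y [b [c [/rR Rb /rQ Qc mbc]]]] := Tz v m vz ma.
  have /(totally_below_star hstar)[b' [c' [b'b c'c a'bc]]] :=
    totally_below_le (lexx a') a'm mbc.
  have [y' y'y Qy'] := Qc z' c' z'v c'c.
  have [x' x'x Rx'] := Rb y' b' y'y b'b.
  exists x' => //; apply/Lrep_compE => // u e /way_belowW uz' /totally_belowW ea'.
  exists y', b', c'; split=> //; last exact: le_trans a'bc.
  exact: rep_le Qy' _ _ _.
apply/Lrep_compE => // z' a' /way_below_interpolation[v z'v vz].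
move=> /totally_below_interpolation[m a'm ma].
have [x' /way_belowW x'x /(Lrep_compE _ _ _ aR aQ)/(_ z' a' z'v a'm)] := Tz v m vz ma.
move=> [y [b [c [Rb Qc a'bc]]]]; exists y, b, c; split=> //.
exact: rep_le Rb _ _ _.
Qed.

Lemma Lrep_compA S1 S2 S3 S4 (R : set (S1 * S2 * L)) (Q : set (S2 * S3 * L))
    (P : set (S3 * S4 * L)) : regular R -> regular Q -> regular P ->
  Lrep_comp star (Lrep_comp star R Q) P = Lrep_comp star R (Lrep_comp star Q P).
Proof.
move=> rR rQ rP; have aR := regular_ambiguous rR; have aQ := regular_ambiguous rQ.
have aP := regular_ambiguous rP.
have aRQ := regular_ambiguous (regular_comp rR rQ).
have aQP := regular_ambiguous (regular_comp rQ rP).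
apply/seteqP; split=> -[[x w] a].
  move=> /(Lrep_compE _ _ _ aRQ aP) Tw; apply/Lrep_compE => // w' a'.
  move=> /way_below_interpolation[v w'v vw].
  move=> /totally_below_interpolation[m a'm ma].
  have [z [b [c [/(Lrep_compE _ _ _ aR aQ) RQ /rP Pc mbc]]]] := Tw v m vw ma.
  have /(totally_below_star hstar)[b' [c' [b'b c'c a'bc]]] :=
    totally_below_le (lexx a') a'm mbc.
  have [z' z'z Pz'] := Pc w' c' w'v c'c.
  (* The composite of [R] and [Q] can be unfolded only strictly below [z], which is why regularity
     of [P] was first used to pass to [z']. *)
  have [y [b1 [b2 [Rb1 Qb2 b'b12]]]] := RQ z' b' z'z b'b.
  exists y, b1, (star b2 c'); split=> //; first exact: mem_Lrep_comp Qb2 Pz'.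
  by rewrite (starA hstar); apply: le_trans a'bc _; exact: star_le.
move=> /(Lrep_compE _ _ _ aR aQP) Tw; apply/Lrep_compE => // w' a'.
move=> /way_below_interpolation[v w'v vw].
move=> /totally_below_interpolation[m a'm ma].
have [y [b [c [Rb /(Lrep_compE _ _ _ aQ aP) QP mbc]]]] := Tw v m vw ma.
have /(totally_below_star hstar)[b' [c' [b'b c'c a'bc]]] :=
  totally_below_le (lexx a') a'm mbc.
have [z [c1 [c2 [Qc1 Pc2 c'c12]]]] := QP w' c' w'v c'c.
exists z, (star b c1), c2; split=> //; first exact: mem_Lrep_comp Rb Qc1.
rewrite -(starA hstar); apply: le_trans a'bc _; apply: star_le => //.
exact: totally_belowW.
Qed.

(** * Crisp arrows given by lower adjoints *)

Section Graph.
Context {S1 S2 : contSemilatticeType d} (f : S1 -> S2) (g : S2 -> S1).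

(** The map [id] gives the identity arrows; [uneval] and [eval] give the natural isomorphism and its
    inverse. *)
Definition graph_rep : set (S1 * S2 * L) :=
  rep_embed [set p : S1 * S2 | p.2 <= f p.1].

Lemma regular_graph : (forall x z, (f x <= z) = (x <= g z)) -> regular graph_rep.
Proof.
move=> fg x z a; rewrite /graph_rep /rep_embed /=.
split=> [[zx|->] z' b z'z ba|zx].
- have [x' x'x z'x'] := adjoint_way_below fg (way_below_le (lexx _) z'z zx).
  by exists x' => //; left.
- by case: (not_totally_below_bot ba).
(* A non-zero degree [b] rules out the alternative of [rep_embed] that holds only at [\bot]. *)
have [a0|/totally_below_neq0[b ba b0]] := pselect (a = \bot); first by right.
left; apply: le_way_below => z' z'z.
have [x' /way_belowW x'x [z'x'|//]] := zx z' b z'z ba.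
apply: le_trans z'x' _; rewrite fg; apply: le_trans x'x _.
by rewrite -fg.
Qed.

Lemma graph_comp S3 (Q : set (S2 * S3 * L)) : Lambiguous_rep graph_rep ->
  Lambiguous_rep Q -> Lrep_comp star graph_rep Q = [set p | Q (f p.1.1, p.1.2, p.2)].
Proof.
move=> af aQ; apply/seteqP; split=> [[[x z] a] /= /(Lrep_compE _ _ _ af aQ) Txz|].
  apply: rep_sup => // z' a' z'z a'a.
  have [y [b [c [/= [/= yx|/= ->] Qc a'bc]]]] := Txz z' a' z'z a'a.
    exact: rep_le Qc yx (lexx _) (le_trans a'bc (star_ler hstar b c)).
  case: aQ => le /(_ (f x))[_ _ Q0] _; apply: le (Q0 z') _ _ _ => //.
  exact: le_trans a'bc (star_lel hstar _ _).
move=> [[x z] a] /= Qa; rewrite -[a](star1x hstar).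
by apply: mem_Lrep_comp Qa => //; left; exact: lexx.
Qed.

(** Here [g] is the lower adjoint of [f]: the graph relates [y] to [z'] exactly when [g z' <= y], so
    composing on the right substitutes [g]. Elements way below [g z] are reached through some [z']
    way below [z]. *)
Lemma comp_graph S3 (Q : set (S3 * S1 * L)) :
  (forall z x, (g z <= x) = (z <= f x)) -> Lambiguous_rep graph_rep ->
  Lambiguous_rep Q -> Lrep_comp star Q graph_rep = [set p | Q (p.1.1, g p.1.2, p.2)].
Proof.
move=> gf af aQ; apply/seteqP; split=> [[[x z] a] /= /(Lrep_compE _ _ _ aQ af) Txz|].
  apply: rep_sup => // y' a' /(adjoint_way_below gf)[z' z'z y'z'] a'a.
  have [y [b [c [Qb /= [/= z'y|/= ->] a'bc]]]] := Txz z' a' z'z a'a.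
    apply: rep_le Qb (lexx _) _ (le_trans a'bc (star_lel hstar b c)) => //.
    by rewrite (le_trans y'z')// gf.
  case: aQ => le /(_ x)[_ _ Q0] _; apply: le (Q0 y') _ _ _ => //.
  exact: le_trans a'bc (star_ler hstar _ _).
move=> [[x z] a] /= Qa; rewrite -[a](starx1 hstar).
by apply: mem_Lrep_comp Qa _ => //; left => /=; rewrite -gf lexx.
Qed.

End Graph.

End Composition.

(** * The duality on composites and on crisp relations *)

Lemma Lrep_dual_comp star S1 S2 S3 (R : set (S1 * S2 * L))
    (Q : set (S2 * S3 * L)) : unital_quantale star -> regular R -> regular Q ->
  Lrep_dual (Lrep_comp star R Q) =
  Lrep_comp (opp_star star) (Lrep_dual Q) (Lrep_dual R).
Proof.
move=> hstar rR rQ; have hstar' := opp_star_unital_quantale hstar.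
have aR := regular_ambiguous rR; have aQ := regular_ambiguous rQ.
have aRQ := regular_ambiguous (regular_comp hstar rR rQ).
have aR' := regular_ambiguous (regular_dual aR).
have aQ' := regular_ambiguous (regular_dual aQ).
apply/seteqP; split=> -[[H F] a].
  move=> /(Lrep_dualE _ _ _ aRQ) RQ; apply/Lrep_compE => // F' a'.
  move=> /way_below_open_filterE[x Fx F'x].
  move=> /totally_below_interpolation[m a'm].
  move=> /totally_below_interpolation[m' mm' m'a].
  have [z [/(Lrep_compE hstar _ _ _ aR aQ) Tz Hz]] := RQ m' x m'a Fx.
  have [z' Hz' z'z] := open_filter_way_below Hz.
  have [y [b [c [Rb /rQ Qc mbc]]]] := Tz z' m z'z mm'.
  have /(totally_below_star hstar)[b' [c' [b'b c'c a'bc]]] :=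
    totally_below_le (lexx a') a'm mbc.
  have [v Hv vz'] := open_filter_way_below Hz'.
  have [y' y'y Qy'] := Qc v c' vz' c'c.
  (* This [G] is the middle filter: all its members lie above [y'], so [v] in [H] witnesses the dual
     of [Q], and it contains [y], which witnesses the dual of [R] on [F']. The degrees appear in the
     order [c'], [b'], whence [opp_star]. *)
  have [G [Gy Gy']] := open_filter_between y'y.
  exists G, c', b'; split=> //; apply/Lrep_dualE => // e u.
    move=> /totally_belowW ec' /Gy' y'u; exists v; split=> //.
    exact: rep_le Qy' y'u (lexx _) ec'.
  move=> /totally_belowW eb' /F'x xu; exists y; split=> //.
  exact: rep_le Rb xu (lexx _) (le_trans eb' (totally_belowW b'b)).
move=> /(Lrep_compE hstar' _ _ _ aQ' aR') T; apply/Lrep_dualE => // a' x.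
move=> /totally_below_interpolation[m a'm ma] /open_filter_basis[F' F'F F'x].
have [G [c [b [/(Lrep_dualE _ _ _ aQ) Qc /(Lrep_dualE _ _ _ aR) Rb mbc]]]] :=
  T F' m F'F ma.
have /(totally_below_star hstar)[b' [c' [b'b c'c a'bc]]] :=
  totally_below_le (lexx a') a'm mbc.
have [y [Ry Gy]] := Rb b' x b'b F'x.
have [z [Qz Hz]] := Qc c' y c'c Gy.
exists z; split=> //; have := mem_Lrep_comp hstar aR aQ Ry Qz.
by move=> /rep_le; apply.
Qed.

Lemma Lrep_dual_embed S1 S2 (R : set (S1 * S2)) :
  Lrep_dual (rep_embed R) = rep_embed (rep_dual R) :> set (_ * _ * L).
Proof.
apply/seteqP; split=> [[[G F] a] /= RGF|[[G F] a] /= [RGF|/= ->] b x /= ba Fx].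
- have [a0|/totally_below_neq0[b ba b0]] := pselect (a = \bot); first by right.
  left=> x Fx; have [y [[Rxy|//] Gy]] :=
    RGF b x (totally_below_way_below ba) Fx.
  by exists y.
- by have [y [Rxy Gy]] := RGF x Fx; exists y; split=> //; left.
(* The empty ideal contains everything totally below [\bot], so nothing is way below [\bot] in
   [L]. *)
- by case: (way_below_ideal (J := set0) _ _ _ ba) => // c /not_totally_below_bot.
Qed.

Lemma rep_dual_id S : rep_dual (@rep_id d S) = @rep_id d (sdual S).
Proof.
apply/seteqP; split=> -[G F] /=.
  move=> GF; apply/open_filter_leP => x /GF[y [/= yx]].
  by move=> /open_filter_up; apply.
by move=> /open_filter_leP FG x Fx; exists x; split; [exact: lexx|exact: FG].
Qed.

End RegularRelations.

(** * The fuzzy categories and the duality functors *)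

Section Categories.
Context (d : Order.disp_t) {dL : Order.disp_t} {L : cdLatticeType dL}.
Implicit Types (star : L -> L -> L) (S : contSemilatticeType d).

Lemma regular_id S : regular (graph_rep (@id S) : set (_ * _ * L)).
Proof. exact: (@regular_graph _ _ _ _ _ id id). Qed.

Lemma SemPRL_category star : unital_quantale star -> is_category (SemPRL d star).
Proof.
move=> hstar; split=> [S|S1 S2 S3 R Q|S1 S2 R|S1 S2 S3 S4 R Q P] /=.
- exact/Lpseudo_invertibleP/regular_id.
- move=> /Lpseudo_invertibleP rR /Lpseudo_invertibleP rQ.
  exact/Lpseudo_invertibleP/regular_comp.
- move=> [aR _]; have aE S := regular_ambiguous (@regular_id S).
  split; [rewrite (graph_comp hstar (aE S1) aR)|
          rewrite (comp_graph hstar (g := id) _ (aE S2) aR) //].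
    by apply/seteqP; split=> -[[]].
  by apply/seteqP; split=> -[[]].
- by do 3![move=> /Lpseudo_invertibleP ?]; exact: Lrep_compA.
Qed.

Lemma Lduality_contravariant star : unital_quantale star ->
  is_contravariant_functor (Lduality d star (opp_star star)).
Proof.
move=> hstar; split=> [|S1 S2 R [aR _]|S|S1 S2 S3 R Q] /=.
- split; apply: SemPRL_category => //; exact: opp_star_unital_quantale.
- exact/Lpseudo_invertibleP/regular_dual.
- by rewrite Lrep_dual_embed rep_dual_id.
- move=> /Lpseudo_invertibleP rR /Lpseudo_invertibleP rQ.
  exact: Lrep_dual_comp.
Qed.

(** Composing with the graph of [uneval] substitutes [uneval] on the left and its adjoint [eval] on
    the right, so naturality reduces to the bidual equation defining pseudo-invertibility. Both
    round trips are instances. *)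
Lemma Lduality_involutive star star' : unital_quantale star ->
  naturally_isomorphic
    (contravariant_comp (Lduality d star star') (Lduality d star' star))
    (id_functor (SemPRL d star)).
Proof.
move=> hstar; pose eta S : set (_ * _ * L) := graph_rep (@uneval d S).
pose eps S : set (_ * _ * L) := graph_rep (@eval d S).
have r_eta S : regular (eta S).
  by apply: (@regular_graph _ _ _ _ _ _ (@eval d S)) => X x; rewrite uneval_le.
have r_eps S : regular (eps S).
  by apply: (@regular_graph _ _ _ _ _ _ (@uneval d S)) => x X; rewrite le_uneval.
have a_eta S := regular_ambiguous (r_eta S).
have a_eps S := regular_ambiguous (r_eps S).
exists eta; split=> [S|S1 S2 R [aR RE]] /=.
  split; first exact/Lpseudo_invertibleP.
  exists (eps S); split; first exact/Lpseudo_invertibleP.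
    rewrite /= (graph_comp hstar (a_eta S) (a_eps S)).
    by apply/seteqP; split=> -[[X Y] a]; rewrite /eps /graph_rep /rep_embed /= unevalK.
  rewrite /= (graph_comp hstar (a_eps S) (a_eta S)).
  by apply/seteqP; split=> -[[x y] a]; rewrite /eta /graph_rep /rep_embed /= evalK.
rewrite (graph_comp hstar (a_eta S1) aR).
rewrite (comp_graph hstar (g := @eval d S2) _ (a_eta S2)) => [|z X|].
- rewrite -{2}RE; apply/seteqP.
  by split=> -[[X z] a]; rewrite /bidual_pullback /= unevalK.
- by rewrite le_uneval.
- apply: regular_ambiguous; apply: regular_dual; apply: regular_ambiguous.
  exact: regular_dual.
Qed.

End Categories.

Theorem proposition4p0p5 (d dL : Order.disp_t) (L : cdLatticeType dL)
    (star : L -> L -> L) (hstar : unital_quantale star) :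
  let F : contravariant_data (SemPRL d star) (SemPRL d (opp_star star)) :=
    Lduality d star (opp_star star) in
  let G : contravariant_data (SemPRL d (opp_star star)) (SemPRL d star) :=
    Lduality d (opp_star star) star in
  let I : functor_data (SemPR d) (SemPRL d star) := embedding d star in
  let I' : functor_data (SemPR d) (SemPRL d (opp_star star)) :=
    embedding d (opp_star star) in
  [/\ is_contravariant_functor F /\ is_contravariant_functor G,
      forall (S1 S2 : SemPR d) (R : arrow S1 S2), is_arrow R ->
        carr F (farr I R) = farr I' (carr (duality d) R),
      forall (S1 S2 : SemPR d) (R : arrow S1 S2), is_arrow R ->
        carr G (farr I' R) = farr I (carr (duality d) R),
      naturally_isomorphic (contravariant_comp F G)
        (id_functor (SemPRL d star)) &
      naturally_isomorphic (contravariant_comp G F)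
        (id_functor (SemPRL d (opp_star star)))].
Proof.
have hstar' := opp_star_unital_quantale hstar.
split=> [|S1 S2 R _|S1 S2 R _||].
- split; first exact: Lduality_contravariant.
  (* Applying [opp_star] twice gives back [star] up to conversion. *)
  exact: (Lduality_contravariant d hstar').
- exact: Lrep_dual_embed.
- exact: Lrep_dual_embed.
- exact: Lduality_involutive.
- exact: Lduality_involutive.
Qed.
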